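(* For each $\theta_0\in(0,\pi/2)$, let $$\mathsf{SNR}(\theta_0)=\frac{1}{\pi}\left[\Big(\frac{\pi}{2}-\theta_0\Big)\Big(1+\frac{1}{2\sin^2\theta_0}\Big)-\frac{3}{2}\cot\theta_0\right],$$ which is the signal-to-noise ratio whose waterfilling cutoff is $\lambda_{\mathrm{cut}}=4\sin^2\theta_0$. Then the full-CSIT capacity $\mathsf{C}$ (in nats per receive antenna) of the square canonical channel at $\mathsf{SNR}=\mathsf{SNR}(\theta_0)$ is $$\mathsf{C}(\theta_0)=-(2\log 2+1)+\frac{4\theta_0}{\pi}\log 2+\frac{2}{\pi}\operatorname{Cl}_2(2\theta_0)+\frac{2\theta_0}{\pi}+\frac{\sin 2\theta_0}{\pi}-\Big(2-\frac{4\theta_0}{\pi}\Big)\log\sin\theta_0 .$$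
   Context: Logarithms are natural. $\operatorname{Cl}_2(x)=\sum_{n\ge1}\frac{\sin nx}{n^2}$ is the Clausen function. The square ($\beta=1$) Marčenko–Pastur density is $f_1(\lambda)=\frac{1}{2\pi}\sqrt{\frac{4-\lambda}{\lambda}}$ for $\lambda\in(0,4]$. The (asymptotic, per-receive-antenna) full-CSIT capacity of the square canonical MIMO channel (IID zero-mean complex Gaussian entries, equal numbers of transmit and receive antennas tending to infinity, full channel state information at the transmitter) at signal-to-noise ratio $\mathsf{SNR}>0$ is the waterfilling integral $$\mathsf{C}(\mathsf{SNR})=\int_{\lambda_{\mathrm{cut}}}^{4}\log(\nu\,\mathsf{SNR}\,\lambda)\,f_1(\lambda)\,d\lambda,$$ where the water level $\nu>0$ and the cutoff $\lambda_{\mathrm{cut}}\in(0,4)$ are determined by $$\lambda_{\mathrm{cut}}=\frac{1}{\mathsf{SNR}\,\nu},\qquad \int_{\lambda_{\mathrm{cut}}}^{4}\Big(\nu-\frac{1}{\mathsf{SNR}\,\lambda}\Big)f_1(\lambda)\,d\lambda=1.$$ The notation $\mathsf{C}(\theta_0)$ means $\mathsf{C}(\mathsf{SNR}(\theta_0))$. *)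

(* Defs.v *)
From Stdlib Require Import Reals.
From Coquelicot Require Import Coquelicot.
Open Scope R_scope.

(* The coefficient of index n of the series is the (n+1)-st term, as the sum
   starts at 1. The series converges absolutely, so [Series] is its true sum. *)
Definition Cl2 (x : R) : R :=
  Series (fun n : nat => sin (INR (S n) * x) / INR (S n) ^ 2).

Definition cot (x : R) : R := cos x / sin x.

(* Square Marchenko-Pastur density. The formula is meaningful on (0, 4], the
   only range over which it is integrated below. *)
Definition f1 (lambda : R) : R :=
  / (2 * PI) * sqrt ((4 - lambda) / lambda).

(* [nu] and [lcut] are a water level and cutoff at signal-to-noise ratio [snr].
   [is_RInt f a b v] includes the integrability of f. *)
Definition is_waterfilling (snr nu lcut : R) : Prop :=
  0 < snr /\ 0 < nu /\ 0 < lcut < 4 /\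
  lcut = 1 / (snr * nu) /\
  is_RInt (fun lambda => (nu - 1 / (snr * lambda)) * f1 lambda) lcut 4 1.

Definition is_cutoff (snr lcut : R) : Prop :=
  exists nu : R, is_waterfilling snr nu lcut.

(* [c] is the full-CSIT capacity, in nats per receive antenna. This is a
   relation because the water level is only given implicitly. *)
Definition is_capacity (snr c : R) : Prop :=
  exists nu lcut : R,
    is_waterfilling snr nu lcut /\
    is_RInt (fun lambda => ln (nu * snr * lambda) * f1 lambda) lcut 4 c.

Definition SNR (theta0 : R) : R :=
  1 / PI * ((PI / 2 - theta0) * (1 + 1 / (2 * sin theta0 ^ 2))
            - 3 / 2 * cot theta0).

(* Main.v *)
Require Import Defs.
From Stdlib Require Import Reals Lra Lia.
From Coquelicot Require Import Coquelicot.
Open Scope R_scope.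

(* Under lambda = 4 sin^2 t the density becomes (4 / PI) cos^2 t dt, so the power
   constraint is an elementary integral whose value SNR is strictly decreasing
   in the cutoff angle; hence cutoff and SNR determine each other. Up to an elementary
   part, the capacity is the integral of ln (sin t), which Cl2 evaluates: Cl2 x is
   the integral of ln (2 sin (t/2)) over [x, PI], because the partial sums of
   sum cos(nt)/n converge to -ln (2 sin (t/2)) uniformly on [x, PI] at rate O(1/N). *)

(* [ring] and [field] do not see that the carrier of a Coquelicot structure is [R]. *)
Ltac as_R := match goal with |- @eq _ ?a ?b => change (@eq R a b) end.

(** * Partial sums of the cosine series *)

(** Both [g + f] and [g - f] have nonnegative derivatives, hence are nondecreasing. Derivative
    bounds thus become error bounds without any integral. *)
Lemma Rabs_diff_le_of_derive (f g df dg : R -> R) (a b : R) :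
  a <= b ->
  (forall x, a <= x <= b -> is_derive f x (df x)) ->
  (forall x, a <= x <= b -> is_derive g x (dg x)) ->
  (forall x, a <= x <= b -> Rabs (df x) <= dg x) ->
  Rabs (f b - f a) <= g b - g a.
Proof.
  intros hab hf hg hle.
  assert (mono : forall h dh : R -> R,
    (forall x, a <= x <= b -> is_derive h x (dh x)) ->
    (forall x, a <= x <= b -> 0 <= dh x) -> h a <= h b).
  { intros h dh hd hpos.
    destruct (MVT_gen h a b dh) as [c [hc heq]];
      rewrite ?Rmin_left, ?Rmax_right in * by lra.
    - intros x hx; apply hd; lra.
    - intros x hx; apply continuity_pt_filterlim.
      apply (ex_derive_continuous h); exists (dh x); apply hd; lra.
    - assert (0 <= dh c * (b - a)) by (apply Rmult_le_pos; [now apply hpos | lra]).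
      lra. }
  apply Rabs_le; split.
  - enough (f a + g a <= f b + g b) by lra.
    apply (mono (fun x => f x + g x) (fun x => df x + dg x)).
    + intros x hx; apply (is_derive_plus f g); auto.
    + intros x hx; specialize (hle x hx); apply Rabs_le_between in hle; lra.
  - enough (g a - f a <= g b - f b) by lra.
    apply (mono (fun x => g x - f x) (fun x => dg x - df x)).
    + intros x hx; apply (is_derive_minus g f); auto.
    + intros x hx; specialize (hle x hx); apply Rabs_le_between in hle; lra.
Qed.

Lemma INR_S_pos (n : nat) : 0 < INR (S n).
Proof. apply lt_0_INR; lia. Qed.

Lemma is_derive_pow_div (n : nat) (x : R) :
  is_derive (fun x => x ^ S n / INR (S n)) x (x ^ n).
Proof.
  pose proof (INR_S_pos n).
  auto_derive; [trivial|simpl in *; field; lra].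
Qed.

(** Truncated Fourier series of -ln (2 sin (t/2)). As in [Cl2], index n carries frequency n + 1, so
    there are N + 1 terms. *)
Definition cos_sum (N : nat) (t : R) : R :=
  sum_n (fun n => cos (INR (S n) * t) / INR (S n)) N.

Lemma cos_INR_PI (n : nat) : cos (INR n * PI) = (-1) ^ n.
Proof.
  induction n as [|n IH].
  - simpl; rewrite Rmult_0_l; apply cos_0.
  - rewrite S_INR, Rmult_plus_distr_r, Rmult_1_l, neg_cos, IH; simpl; ring.
Qed.

(** The sum is the derivative of a Taylor polynomial of -ln (1 + x); the explicit remainder yields
    the rate at PI. *)
Lemma sum_n_geom_neg (N : nat) (x : R) :
  0 <= x ->
  sum_n (fun n => (-1) ^ S n * x ^ n) N = - / (1 + x) + (-1) ^ S N * x ^ S N / (1 + x).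
Proof.
  intros hx; induction N as [|N IH].
  - rewrite sum_O; simpl; field; lra.
  - rewrite sum_Sn, IH; unfold plus; simpl; field; lra.
Qed.

(** At PI the cosines alternate in sign and the sum is an alternating harmonic one. [P] is ln (1 +
    x) minus its Taylor polynomial: it vanishes at 0, and its derivative is bounded by x^(N+1), the
    derivative of [g]. *)
Lemma cos_sum_PI (N : nat) : Rabs (cos_sum N PI + ln 2) <= / INR (S (S N)).
Proof.
  set (P := fun x => sum_n (fun n => (-1) ^ S n * (x ^ S n / INR (S n))) N + ln (1 + x)).
  set (g := fun x => x ^ S (S N) / INR (S (S N))).
  assert (hP : forall x, 0 <= x <= 1 ->
    is_derive P x (sum_n (fun n => (-1) ^ S n * x ^ n) N + / (1 + x))).
  { intros x hx; apply (is_derive_plus (V := R_NormedModule)).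
    - apply (is_derive_sum_n (K := R_AbsRing) (V := R_NormedModule)
        (fun n x => (-1) ^ S n * (x ^ S n / INR (S n)))).
      intros k _; apply (is_derive_scal (fun x => x ^ S k / INR (S k))), is_derive_pow_div.
    - auto_derive; [lra|field; lra]. }
  assert (hg : forall x, 0 <= x <= 1 -> is_derive g x (x ^ S N)).
  { intros x _; apply is_derive_pow_div. }
  pose proof (Rabs_diff_le_of_derive P g _ _ 0 1 ltac:(lra) hP hg) as H.
  assert (h0 : P 0 = 0).
  { unfold P; rewrite Rplus_0_r, ln_1, Rplus_0_r.
    rewrite (sum_n_ext _ (fun _ => 0)).
    - rewrite sum_n_const; ring.
    - intros n; simpl; unfold Rdiv; ring. }
  assert (h1 : P 1 = cos_sum N PI + ln 2).
  { unfold P, cos_sum; replace (1 + 1) with 2 by ring; f_equal.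
    apply sum_n_ext; intros n; rewrite cos_INR_PI, pow1; unfold Rdiv; now rewrite Rmult_1_l. }
  rewrite h0, h1 in H; unfold g in H.
  rewrite pow1, pow_ne_zero, Rminus_0_r in H by lia.
  unfold Rdiv in H; rewrite Rmult_0_l, Rminus_0_r, Rmult_1_l in H.
  apply H; intros x hx; rewrite sum_n_geom_neg by lra.
  replace (- / (1 + x) + (-1) ^ S N * x ^ S N / (1 + x) + / (1 + x))
    with ((-1) ^ S N * x ^ S N * / (1 + x)) by (simpl; field; lra).
  assert (0 <= x ^ S N) by (apply pow_le; lra).
  rewrite !Rabs_mult, pow_1_abs, Rmult_1_l, Rabs_pos_eq by trivial.
  rewrite <- (Rmult_1_r (x ^ S N)) at 2.
  apply Rmult_le_compat_l; trivial.
  rewrite Rabs_pos_eq, <- Rinv_1; [apply Rinv_le_contravar|apply Rlt_le, Rinv_0_lt_compat]; lra.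
Qed.

(** Each product is a difference of cosines at neighbouring half-integers, so the sum telescopes.
    The top frequency is N + 1, whence N + 3/2. *)
Lemma sum_n_sin (N : nat) (t : R) :
  2 * sin (t / 2) * sum_n (fun n => sin (INR (S n) * t)) N
  = cos (t / 2) - cos ((INR N + 3 / 2) * t).
Proof.
  assert (step : forall a, 2 * sin (t / 2) * sin (a * t)
    = cos ((a - / 2) * t) - cos ((a + / 2) * t)).
  { intros a.
    replace ((a - / 2) * t) with (a * t - t / 2) by field.
    replace ((a + / 2) * t) with (a * t + t / 2) by field.
    rewrite cos_minus, cos_plus; ring. }
  induction N as [|N IH].
  - rewrite sum_O, step; f_equal; f_equal; simpl; field.
  - rewrite sum_Sn; change (@plus R_AbelianMonoid) with Rplus.
    rewrite Rmult_plus_distr_l, IH, step, !S_INR.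
    replace (INR N + 1 + 1 - / 2) with (INR N + 3 / 2) by field.
    replace (INR N + 1 + 1 + / 2) with (INR N + 1 + 3 / 2) by field. ring.
Qed.

Lemma is_derive_cos_sum (N : nat) (t : R) :
  is_derive (cos_sum N) t (- sum_n (fun n => sin (INR (S n) * t)) N).
Proof.
  replace (- _) with (sum_n (fun n => - 1 * sin (INR (S n) * t)) N)
    by (rewrite (sum_n_mult_l (K := R_Ring)); 
        change (- 1 * sum_n (fun n => sin (INR (S n) * t)) N
          = - sum_n (fun n => sin (INR (S n) * t)) N); ring).
  apply (is_derive_sum_n (K := R_AbsRing) (V := R_NormedModule)
    (fun n t => cos (INR (S n) * t) / INR (S n))).
  intros k _; pose proof (INR_S_pos k).
  auto_derive; [trivial|]. simpl in *; field; lra.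
Qed.

Lemma sin_half_le (x t : R) : 0 < x -> x <= t <= PI -> 0 < sin (x / 2) <= sin (t / 2).
Proof.
  intros hx ht; split.
  - apply sin_gt_0; lra.
  - apply sin_incr_1; lra.
Qed.

(* Subtracting the oscillating term
   sin((N+3/2)t) / (2(N+3/2) sin(t/2)) leaves a function of derivative O(1/N). *)
Lemma cos_sum_approx (x : R) :
  0 < x <= PI ->
  exists C, forall N t, x <= t <= PI ->
    Rabs (cos_sum N t + ln (2 * sin (t / 2))) <= C / INR (S N).
Proof.
  intros hx; set (s := sin (x / 2)).
  assert (hs : 0 < s) by (apply sin_gt_0; lra).
  (* The 2 covers the errors at PI (1 from [cos_sum_PI], 1/2 from [osc PI]), the second term covers
     [osc t], the third the variation of [E] over an interval of length at most PI. *)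
  exists (2 + / (2 * s) + / (4 * s ^ 2) * PI).
  intros N t ht.
  pose proof (INR_S_pos N) as hN; rewrite S_INR in hN.
  set (M := INR N + 3 / 2).
  assert (hM : 0 < M) by (unfold M; lra).
  set (osc := fun u => sin (M * u) / (2 * M * sin (u / 2))).
  set (E := fun u => cos_sum N u + ln (2 * sin (u / 2)) - osc u).
  set (dE := fun u => sin (M * u) * cos (u / 2) / (4 * M * sin (u / 2) ^ 2)).
  (* The first two terms of [E] have derivative cos (M u) / (2 sin (u/2)), which does not decay.
     Differentiating the numerator of [osc] cancels it; differentiating its denominator leaves [dE],
     with a factor 1/M. *)
  assert (hE : forall u, t <= u <= PI -> is_derive E u (dE u)).
  { intros u hu; destruct (sin_half_le x u) as [_ hsu]; [lra..|]; fold s in hsu.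
    set (D := - sum_n (fun n => sin (INR (S n) * u)) N).
    assert (hD : D = - (cos (u / 2) - cos (M * u)) / (2 * sin (u / 2))).
    { unfold D, M; rewrite <- sum_n_sin; field; lra. }
    replace (dE u) with (D + cos (u / 2) / (2 * sin (u / 2))
      - (cos (M * u) / (2 * sin (u / 2)) - dE u))
      by (rewrite hD; field; lra).
    apply (is_derive_minus (V := R_NormedModule));
      [apply (is_derive_plus (V := R_NormedModule)); [apply is_derive_cos_sum|]|].
    - auto_derive; [lra|unfold Rdiv in *; field; lra].
    - unfold osc, dE; auto_derive; [|unfold Rdiv in *; field; lra].
      apply Rmult_integral_contrapositive; lra. }
  assert (hg : forall u, t <= u <= PI ->
    is_derive (fun u => / (4 * M * s ^ 2) * u) u (/ (4 * M * s ^ 2))).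
  { intros u _; generalize (/ (4 * M * s ^ 2)); intros c; auto_derive; [trivial|ring]. }
  assert (hs2 : 0 < s ^ 2) by (apply pow_lt; lra).
  assert (hp : 0 < / (4 * M * s ^ 2)).
  { apply Rinv_0_lt_compat, Rmult_lt_0_compat; lra. }
  assert (sin1 : forall y, Rabs (sin y) <= 1) by (intros y; apply Rabs_le, SIN_bound).
  assert (hle : forall u, t <= u <= PI -> Rabs (dE u) <= / (4 * M * s ^ 2)).
  { intros u hu; destruct (sin_half_le x u) as [_ hsu]; [lra..|]; fold s in hsu.
    assert (s ^ 2 <= sin (u / 2) ^ 2) by (apply pow_incr; lra).
    unfold dE, Rdiv; rewrite !Rabs_mult, Rabs_inv, (Rabs_pos_eq (4 * _ * _))
      by (apply Rmult_le_pos; nra).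
    rewrite <- (Rmult_1_l (/ (4 * M * s ^ 2))).
    apply Rmult_le_compat.
    - apply Rmult_le_pos; apply Rabs_pos.
    - apply Rlt_le, Rinv_0_lt_compat, Rmult_lt_0_compat; lra.
    - rewrite <- (Rmult_1_l 1); apply Rmult_le_compat; try apply Rabs_pos.
      + apply sin1.
      + apply Rabs_le, COS_bound.
    - apply Rinv_le_contravar; [apply Rmult_lt_0_compat; lra|].
      apply Rmult_le_compat_l; lra. }
  pose proof (Rabs_diff_le_of_derive E _ dE _ t PI ltac:(lra) hE hg hle) as key.
  assert (hosc : forall u, x <= u <= PI -> Rabs (osc u) <= / (2 * M * s)).
  { intros u hu; destruct (sin_half_le x u) as [_ hsu]; [lra..|]; fold s in hsu.
    unfold osc, Rdiv.
    rewrite Rabs_mult, Rabs_inv, (Rabs_pos_eq (2 * _ * _)) by (apply Rmult_le_pos; lra).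
    rewrite <- (Rmult_1_l (/ (2 * M * s))).
    apply Rmult_le_compat; [apply Rabs_pos| |apply sin1|].
    - apply Rlt_le, Rinv_0_lt_compat, Rmult_lt_0_compat; lra.
    - apply Rinv_le_contravar; [apply Rmult_lt_0_compat; lra|].
      apply Rmult_le_compat_l; lra. }
  assert (hoscPI : Rabs (osc PI) <= / (2 * M)).
  { unfold osc; rewrite sin_PI2, Rmult_1_r; unfold Rdiv.
    rewrite Rabs_mult, Rabs_inv, (Rabs_pos_eq (2 * _)) by lra.
    rewrite <- (Rmult_1_l (/ (2 * M))) at 2.
    apply Rmult_le_compat_r; [apply Rlt_le, Rinv_0_lt_compat; lra|apply sin1]. }
  pose proof (cos_sum_PI N) as hPI.
  specialize (hosc t ht).
  set (F := cos_sum N t + ln (2 * sin (t / 2))).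
  (* The error at [t] is carried over from PI, where the logarithm is ln 2. *)
  assert (hF : F = osc t - (E PI - E t) + (cos_sum N PI + ln 2) - osc PI).
  { unfold E, F; rewrite sin_PI2, Rmult_1_r; ring. }
  rewrite hF.
  assert (tri : forall a b c d : R, Rabs (a - b + c - d)
      <= Rabs a + Rabs b + Rabs c + Rabs d).
  { intros a b c d.
    pose proof (Rabs_triang (a - b + c) (- d)); pose proof (Rabs_triang (a - b) c).
    pose proof (Rabs_triang a (- b)).
    rewrite Rabs_Ropp in *; unfold Rminus in *; lra. }
  eapply Rle_trans; [apply tri|].
  assert (hinv : / M <= / INR (S N)).
  { apply Rinv_le_contravar; rewrite S_INR; unfold M; lra. }
  assert (hinv2 : / INR (S (S N)) <= / INR (S N)).
  { apply Rinv_le_contravar; rewrite !S_INR; lra. }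
  assert (hMp : 0 < / M) by (apply Rinv_0_lt_compat; lra).
  rewrite !Rinv_mult in *.
  assert (hsp : 0 < / s) by (apply Rinv_0_lt_compat; lra).
  assert (hsp2 : 0 < / s ^ 2) by (apply Rinv_0_lt_compat; lra).
  assert (h1 : / s * / M <= / s * / INR (S N)) by (apply Rmult_le_compat_l; lra).
  assert (h2 : PI * / s ^ 2 * / M <= PI * / s ^ 2 * / INR (S N)).
  { apply Rmult_le_compat_l; [apply Rmult_le_pos; lra|lra]. }
  assert (h3 : / 4 * / M * / s ^ 2 * PI - / 4 * / M * / s ^ 2 * t
    <= / 4 * (PI * / s ^ 2 * / M)).
  { assert (0 <= / 4 * / M * / s ^ 2 * t); [|nra].
    repeat apply Rmult_le_pos; lra. }
  unfold Rdiv; nra.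
Qed.

(** * The Clausen function as a log-sine integral *)

(** The partial sum [G N] of [Cl2] is an antiderivative of [cos_sum N] and vanishes at PI. Hence
    [l - G N x] is the integral of [cos_sum N + phi] over [x, PI], which the uniform bound sends to
    0. *)
Lemma is_RInt_Cl2 (x : R) :
  0 < x <= PI -> is_RInt (fun t => ln (2 * sin (t / 2))) x PI (Cl2 x).
Proof.
  intros hx; set (phi := fun t => ln (2 * sin (t / 2))).
  assert (hphi : ex_RInt phi x PI).
  { apply (ex_RInt_continuous (V := R_CompleteNormedModule)).
    intros t; rewrite Rmin_left, Rmax_right by lra; intros ht.
    apply (ex_derive_continuous phi); unfold phi.
    destruct (sin_half_le x t); [lra..|]; auto_derive; lra. }
  destruct hphi as [l hl].
  enough (hCl : Cl2 x = l) by now rewrite hCl.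
  destruct (cos_sum_approx x hx) as [C hC].
  set (G := fun N t => sum_n (fun n => sin (INR (S n) * t) / INR (S n) ^ 2) N).
  assert (hG : forall N t, is_derive (G N) t (cos_sum N t)).
  { intros N t; apply (is_derive_sum_n (K := R_AbsRing) (V := R_NormedModule)
      (fun n t => sin (INR (S n) * t) / INR (S n) ^ 2)).
    intros k _; pose proof (INR_S_pos k).
    auto_derive; [trivial|simpl in *; field; lra]. }
  assert (hGPI : forall N, G N PI = 0).
  { intros N; unfold G; rewrite (sum_n_ext _ (fun _ => 0)).
    - rewrite sum_n_const; apply Rmult_0_r.
    - intros n; rewrite (sin_eq_0_1 (INR (S n) * PI)); [unfold Rdiv; apply Rmult_0_l|].
      exists (Z.of_nat (S n)); now rewrite <- INR_IZR_INZ. }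
  assert (bound : forall N, Rabs (l - G N x) <= (PI - x) * (C / INR (S N))).
  { intros N.
    replace (l - G N x) with (plus (minus (G N PI) (G N x)) l)
      by (unfold plus, minus, opp; simpl; rewrite hGPI; unfold plus; simpl; ring).
    apply (norm_RInt_le_const (V := R_NormedModule)
      (fun t => plus (cos_sum N t) (phi t)) x PI); [lra|apply hC|].
    apply (is_RInt_plus (V := R_NormedModule)); [|exact hl].
    apply (is_RInt_derive (V := R_CompleteNormedModule)).
    - intros t _; apply hG.
    - intros t _; apply (ex_derive_continuous (cos_sum N)).
      eexists; apply is_derive_cos_sum. }
  apply is_series_unique.
  change (is_lim_seq (fun N => G N x) l).
  assert (lim0 : is_lim_seq (fun N => (PI - x) * (C / INR (S N))) 0).
  { replace (Finite 0) with (Rbar_mult ((PI - x) * C) (Rbar_inv p_infty))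
      by (simpl; f_equal; ring).
    apply is_lim_seq_ext with (fun N => (PI - x) * C * / INR (S N)).
    - intros N; unfold Rdiv; ring.
    - apply is_lim_seq_scal_l, is_lim_seq_inv; [|discriminate].
      apply (is_lim_seq_incr_1 INR), is_lim_seq_INR. }
  apply is_lim_seq_ext with (fun N => l - (l - G N x)); [intros N; ring|].
  replace (Finite l) with (Finite (l - 0)) by (f_equal; ring).
  apply is_lim_seq_minus'; [apply is_lim_seq_const|].
  apply is_lim_seq_abs_0.
  apply is_lim_seq_le_le with (fun _ => 0) (fun N => (PI - x) * (C / INR (S N)));
    [|apply is_lim_seq_const|exact lim0].
  intros N; split; [apply Rabs_pos|apply bound].
Qed.

Lemma is_RInt_ln_sin (theta : R) :
  0 < theta < PI / 2 ->
  is_RInt (fun t => ln (sin t)) theta (PI / 2)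
    (Cl2 (2 * theta) / 2 - (PI / 2 - theta) * ln 2).
Proof.
  intros ht.
  (* The added zeros give the bounds the affine shape expected by [is_RInt_comp_lin]; the factor 2
     it produces is then scaled away. *)
  assert (h : is_RInt (fun t => ln (2 * sin (t / 2))) (2 * theta + 0) (2 * (PI / 2) + 0)
    (Cl2 (2 * theta))).
  { replace (2 * (PI / 2) + 0) with PI by field; rewrite Rplus_0_r.
    apply is_RInt_Cl2; lra. }
  apply (is_RInt_comp_lin (V := R_NormedModule)) in h.
  apply (is_RInt_scal (V := R_NormedModule) _ _ _ (/ 2)) in h.
  pose proof (is_RInt_minus (V := R_NormedModule) _ _ _ _ _ _ h
    (is_RInt_const (V := R_NormedModule) theta (PI / 2) (ln 2))) as h'.
  revert h'; unfold minus, plus, opp, scal; simpl; unfold mult; simpl; intros h'.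
  replace (Cl2 (2 * theta) / 2 - (PI / 2 - theta) * ln 2)
    with (/ 2 * Cl2 (2 * theta) + - ((PI / 2 - theta) * ln 2)) by field.
  apply (is_RInt_ext (V := R_NormedModule)) with (2 := h').
  intros t; rewrite Rmin_left, Rmax_right by lra; intros htt.
  replace ((2 * t + 0) / 2) with t by field.
  rewrite ln_mult; [as_R; field|lra|apply sin_gt_0; lra].
Qed.

(** * Trigonometric substitution and the power constraint *)

(* The substitution lambda = 4 sin^2 theta turns f1(lambda) dlambda
   into (4 / PI) cos^2 theta dtheta. *)
Lemma is_RInt_f1_subst (h : R -> R) (theta v : R) :
  0 < theta < PI / 2 ->
  (forall l, 0 < l -> continuous h l) ->
  is_RInt (fun t => h (4 * sin t ^ 2) * cos t ^ 2) theta (PI / 2) v ->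
  is_RInt (fun l => h l * f1 l) (4 * sin theta ^ 2) 4 (4 / PI * v).
Proof.
  intros ht hh hv.
  pose proof PI_RGT_0 as hPI.
  assert (spos : forall t, theta <= t <= PI / 2 -> 0 < sin t)
    by (intros t htt; apply sin_gt_0; lra).
  assert (hcont : forall l, 0 < l -> continuous (fun l => h l * f1 l) l).
  { intros l hl; apply (continuous_mult (K := R_AbsRing)); [now apply hh|].
    apply (continuous_mult (K := R_AbsRing)); [apply continuous_const|].
    apply continuous_sqrt_comp, (ex_derive_continuous (fun l => (4 - l) / l)).
    auto_derive; lra. }
  assert (gpos : forall t, theta <= t <= PI / 2 -> 0 < 4 * sin t ^ 2).
  { intros t htt; pose proof (pow_lt (sin t) 2 (spos t htt)); lra. }
  assert (hle : 4 * sin theta ^ 2 <= 4).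
  { pose proof (sin2_cos2 theta); unfold Rsqr in *.
    pose proof (pow2_ge_0 (cos theta)); simpl in *; nra. }
  assert (hex : ex_RInt (fun l => h l * f1 l) (4 * sin theta ^ 2) 4).
  { apply (ex_RInt_continuous (V := R_CompleteNormedModule)); intros z.
    specialize (gpos theta ltac:(lra)).
    rewrite Rmin_left by trivial; intros hz; apply hcont; lra. }
  destruct hex as [w hw].
  enough (w = 4 / PI * v) by (subst w; exact hw).
  assert (hs := is_RInt_comp (V := R_CompleteNormedModule) (fun l => h l * f1 l)
    (fun t => 4 * sin t ^ 2) (fun t => 8 * sin t * cos t) theta (PI / 2)).
  rewrite Rmin_left, Rmax_right in hs by lra.
  specialize (hs (fun t htt => hcont _ (gpos t htt))).
  rewrite sin_PI2 in hs; replace (4 * 1 ^ 2) with 4 in hs by ring.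
  rewrite (is_RInt_unique _ _ _ _ hw) in hs.
  assert (hs' : is_RInt (fun y => scal (8 * sin y * cos y)
      (h (4 * sin y ^ 2) * f1 (4 * sin y ^ 2))) theta (PI / 2) w).
  { apply hs; intros t _; split.
    - auto_derive; [trivial|ring].
    - apply (ex_derive_continuous (fun t => 8 * sin t * cos t)); auto_derive; trivial. }
  apply (is_RInt_scal (V := R_NormedModule) _ _ _ (4 / PI)) in hv.
  rewrite <- (is_RInt_unique (V := R_CompleteNormedModule) _ _ _ _ hs').
  apply (is_RInt_unique (V := R_CompleteNormedModule)).
  apply (is_RInt_ext (V := R_NormedModule)) with (2 := hv).
  intros t; rewrite Rmin_left, Rmax_right by lra; intros htt.
  unfold scal; simpl; unfold mult; simpl.
  specialize (spos t ltac:(lra)).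
  assert (hc : 0 < cos t) by (apply cos_gt_0; lra).
  unfold f1.
  replace ((4 - 4 * (sin t * (sin t * 1))) / (4 * (sin t * (sin t * 1))))
    with ((cos t / sin t)²).
  - rewrite sqrt_Rsqr by (apply Rlt_le, Rdiv_lt_0_compat; lra).
    field; lra.
  - pose proof (sin2_cos2 t) as e; unfold Rsqr in *.
    replace (4 - 4 * (sin t * (sin t * 1))) with (4 * (cos t * cos t)) by lra.
    field; lra.
Qed.

(** This is the power constraint multiplied by the SNR: the cutoff equation turns the product of SNR
    and water level into the reciprocal of the cutoff. *)
Lemma is_RInt_waterfilling (theta : R) :
  0 < theta < PI / 2 ->
  is_RInt (fun l => (/ (4 * sin theta ^ 2) - / l) * f1 l)
    (4 * sin theta ^ 2) 4 (SNR theta).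
Proof.
  intros ht; pose proof PI_RGT_0 as hPI.
  assert (spos : forall t, theta <= t <= PI / 2 -> 0 < sin t)
    by (intros t htt; apply sin_gt_0; lra).
  set (k := / (4 * sin theta ^ 2)).
  (* The first bracket integrates cos^2 t; t + cot t has derivative -cot^2 t. *)
  set (A := fun t => k * (t / 2 + sin t * cos t / 2) + (t + cos t / sin t) / 4).
  replace (SNR theta) with (4 / PI * (A (PI / 2) - A theta)).
  - apply is_RInt_f1_subst; trivial.
    + intros l hl; apply (ex_derive_continuous (fun l => k - / l)); auto_derive; lra.
    + apply (is_RInt_derive (V := R_CompleteNormedModule) A
        (fun t => (k - / (4 * sin t ^ 2)) * cos t ^ 2));
        intros t; rewrite Rmin_left, Rmax_right by lra; intros htt;
        specialize (spos t htt).
      * unfold A; auto_derive; [lra|].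
        pose proof (sin2_cos2 t) as e; unfold Rsqr in e.
        replace ((k - / (4 * sin t ^ 2)) * cos t ^ 2)
          with (k * (cos t * cos t) - cos t * cos t / (4 * sin t ^ 2)) by (field; lra).
        replace (k * (1 * / 2 + (1 * cos t * cos t + sin t * (1 * - sin t)) * / 2))
          with (k * ((1 + (cos t * cos t - sin t * sin t)) / 2)) by field.
        replace (1 + (cos t * cos t - sin t * sin t)) with (2 * (cos t * cos t)) by lra.
        field; lra.
      * apply (ex_derive_continuous (fun t => (k - / (4 * sin t ^ 2)) * cos t ^ 2)).
        auto_derive; repeat split; nra.
  - unfold A, SNR, k, cot; rewrite sin_PI2, cos_PI2.
    specialize (spos theta ltac:(lra)); field; lra.
Qed.

(** * Monotonicity of the SNR in the angle *)

(** The sign of the derivative is that of sin c cos c - (PI/2 - c), negative because sin y < y at y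
    = PI/2 - c. The mean value point is interior, so cos c > 0 even if [b] is PI/2. *)
Lemma SNR_decreasing (a b : R) : 0 < a -> a < b -> b <= PI / 2 -> SNR b < SNR a.
Proof.
  intros ha hab hb; pose proof PI_RGT_0 as hPI.
  set (d := fun t => / PI * (cos t / sin t ^ 3) * (sin t * cos t - (PI / 2 - t))).
  assert (hd : forall t, a <= t <= b -> is_derive SNR t (d t)).
  { intros t ht; assert (0 < sin t) by (apply sin_gt_0; lra).
    unfold SNR, cot, d; auto_derive.
    - repeat split; nra.
    - pose proof (sin2_cos2 t) as e; unfold Rsqr in e.
      replace (1 * / (2 * (sin t * (sin t * 1))))
        with ((sin t * sin t + cos t * cos t) / (2 * sin t ^ 2))
        by (rewrite e; field; lra).
      field; lra. }
  destruct (MVT_cor2 SNR d a b hab) as [c [heq hc]].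
  { intros t ht; apply is_derive_Reals; auto. }
  assert (hs : 0 < sin c) by (apply sin_gt_0; lra).
  assert (hcos : 0 < cos c) by (apply cos_gt_0; lra).
  assert (hlt : sin c * cos c < PI / 2 - c).
  { pose proof (sin_lt_x (PI / 2 - c) ltac:(lra)) as h; rewrite sin_shift in h.
    pose proof (SIN_bound c); nra. }
  assert (0 < / PI * (cos c / sin c ^ 3)).
  { apply Rmult_lt_0_compat; [apply Rinv_0_lt_compat; lra|].
    apply Rdiv_lt_0_compat; [lra|apply pow_lt; lra]. }
  assert (d c < 0) by (unfold d; nra).
  nra.
Qed.

(** [SNR] decreases to 0 at PI/2, where the cutoff would reach 4. *)
Lemma SNR_pos (theta : R) : 0 < theta < PI / 2 -> 0 < SNR theta.
Proof.
  intros ht; replace 0 with (SNR (PI / 2)).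
  - apply SNR_decreasing; lra.
  - unfold SNR, cot; rewrite cos_PI2, sin_PI2; field; apply PI_neq0.
Qed.

Lemma SNR_inj (a b : R) :
  0 < a < PI / 2 -> 0 < b < PI / 2 -> SNR a = SNR b -> a = b.
Proof.
  intros ha hb e; destruct (Rtotal_order a b) as [h|[h|h]]; trivial.
  - pose proof (SNR_decreasing a b); lra.
  - pose proof (SNR_decreasing b a); lra.
Qed.

Lemma four_sin_sq_bounds (theta : R) :
  0 < theta < PI / 2 -> 0 < 4 * sin theta ^ 2 < 4.
Proof.
  intros ht; assert (0 < sin theta) by (apply sin_gt_0; lra).
  assert (0 < cos theta) by (apply cos_gt_0; lra).
  pose proof (sin2_cos2 theta); unfold Rsqr in *; nra.
Qed.

(** * Correspondence between cutoff and SNR *)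

(** For a water level satisfying the cutoff equation, the power integral is [SNR theta / snr], which
    is 1 exactly when the two agree. *)
Lemma is_cutoff_iff_SNR (theta snr : R) :
  0 < theta < PI / 2 -> is_cutoff snr (4 * sin theta ^ 2) <-> snr = SNR theta.
Proof.
  intros ht; pose proof (four_sin_sq_bounds theta ht) as hb.
  pose proof (is_RInt_waterfilling theta ht) as hI.
  assert (scaled : forall snr' nu, 0 < snr' -> 0 < nu ->
    4 * sin theta ^ 2 = 1 / (snr' * nu) ->
    is_RInt (fun l => (nu - 1 / (snr' * l)) * f1 l) (4 * sin theta ^ 2) 4
      (/ snr' * SNR theta)).
  { intros s nu hs hnu e.
    apply (is_RInt_scal (V := R_NormedModule) _ _ _ (/ s)) in hI.
    apply (is_RInt_ext (V := R_NormedModule)) with (2 := hI).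
    intros l; rewrite Rmin_left, Rmax_right by lra; intros hl.
    unfold scal; cbn -[pow]; unfold mult; cbn -[pow].
    rewrite e; field; lra. }
  split.
  - intros [nu (hs & hnu & _ & e & hi)].
    specialize (scaled snr nu hs hnu e).
    pose proof (is_RInt_unique (V := R_CompleteNormedModule) _ _ _ _ scaled) as e1.
    rewrite (is_RInt_unique (V := R_CompleteNormedModule) _ _ _ _ hi) in e1.
    apply (Rmult_eq_reg_l (/ snr)); [|apply Rinv_neq_0_compat; lra].
    rewrite <- e1; field; lra.
  - intros ->; pose proof (SNR_pos theta ht) as hs.
    (* The cutoff equation solved for the water level. *)
    exists (1 / (SNR theta * (4 * sin theta ^ 2))).
    assert (hnu : 0 < 1 / (SNR theta * (4 * sin theta ^ 2))).
    { apply Rdiv_lt_0_compat; [lra|apply Rmult_lt_0_compat; lra]. }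
    assert (e : 4 * sin theta ^ 2
      = 1 / (SNR theta * (1 / (SNR theta * (4 * sin theta ^ 2))))).
    { field; split; [|lra]; intros h0; rewrite h0 in hb; lra. }
    repeat split; try lra; trivial.
    generalize (scaled _ _ hs hnu e); rewrite Rinv_l by lra; trivial.
Qed.

Lemma exists_angle (lcut : R) :
  0 < lcut < 4 -> exists theta, 0 < theta < PI / 2 /\ lcut = 4 * sin theta ^ 2.
Proof.
  intros hl; set (r := sqrt lcut / 2); exists (asin r).
  assert (hr : r * r = lcut / 4).
  { unfold r; pose proof (sqrt_sqrt lcut); lra. }
  assert (hr0 : 0 < r) by (pose proof (sqrt_lt_R0 lcut); unfold r; lra).
  assert (hr1 : r < 1) by nra.
  split.
  - pose proof (asin_bound_lt r); split; [|lra].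
    apply sin_increasing_0; rewrite ?sin_0, ?sin_asin; lra.
  - rewrite sin_asin by lra; lra.
Qed.

(** Any admissible cutoff comes from an angle, and injectivity of [SNR] identifies that angle with
    [theta]. *)
Lemma is_cutoff_SNR_iff (theta lcut : R) :
  0 < theta < PI / 2 ->
  is_cutoff (SNR theta) lcut <-> lcut = 4 * sin theta ^ 2.
Proof.
  intros ht; split.
  - intros h; assert (hl : 0 < lcut < 4) by (destruct h as [nu h]; apply h).
    destruct (exists_angle lcut hl) as [t [htt ->]].
    apply is_cutoff_iff_SNR in h; trivial.
    now rewrite (SNR_inj _ _ ht htt h).
  - intros ->; now apply is_cutoff_iff_SNR.
Qed.

(** * The capacity integral *)

(* In [2 cos^2 t * ln (sin t) = ln (sin t) + cos (2t) * ln (sin t)] the last term has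
   the elementary antiderivative [sin t * cos t * ln (sin t) - (t + sin t * cos t) / 2]. *)
Lemma is_RInt_capacity (theta : R) :
  0 < theta < PI / 2 ->
  is_RInt (fun l => ln (/ (4 * sin theta ^ 2) * l) * f1 l) (4 * sin theta ^ 2) 4
    (- (2 * ln 2 + 1) + 4 * theta / PI * ln 2
     + 2 / PI * Cl2 (2 * theta) + 2 * theta / PI
     + sin (2 * theta) / PI
     - (2 - 4 * theta / PI) * ln (sin theta)).
Proof.
  intros ht; pose proof PI_RGT_0 as hPI.
  assert (spos : forall t, theta <= t <= PI / 2 -> 0 < sin t)
    by (intros t htt; apply sin_gt_0; lra).
  pose proof (four_sin_sq_bounds theta ht) as hb.
  set (c := ln (sin theta)).
  set (A := fun t => sin t * cos t * (ln (sin t) - c) - c * t - (t + sin t * cos t) / 2).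
  (* After substitution the integrand is 2 cos^2 t (ln (sin t) - c), the constant [c] coming from
     the cutoff. [dA] is this minus ln (sin t), which [hsum] adds back. *)
  set (dA := fun t => ln (sin t) * (2 * cos t ^ 2 - 1) - 2 * c * cos t ^ 2).
  assert (hA : is_RInt dA theta (PI / 2) (A (PI / 2) - A theta)).
  { apply (is_RInt_derive (V := R_CompleteNormedModule));
      intros t; rewrite Rmin_left, Rmax_right by lra; intros htt;
      specialize (spos t htt).
    - unfold A, dA; auto_derive; [lra|].
      pose proof (sin2_cos2 t) as e; unfold Rsqr in e.
      replace (1 * cos t * cos t + sin t * (1 * - sin t)) with (2 * cos t ^ 2 - 1) by lra.
      field; lra.
    - apply (ex_derive_continuous dA); unfold dA; auto_derive; lra. }
  pose proof (is_RInt_plus (V := R_NormedModule) _ _ _ _ _ _ hA (is_RInt_ln_sin theta ht))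
    as hsum.
  replace (_ - _) with (4 / PI *
    (A (PI / 2) - A theta + (Cl2 (2 * theta) / 2 - (PI / 2 - theta) * ln 2))).
  - apply is_RInt_f1_subst; trivial.
    + intros l hl; apply (ex_derive_continuous (fun l => ln (/ (4 * sin theta ^ 2) * l))).
      auto_derive.
      apply Rmult_lt_0_compat; [apply Rinv_0_lt_compat|]; lra.
    + apply (is_RInt_ext (V := R_NormedModule)) with (2 := hsum).
      intros t; rewrite Rmin_left, Rmax_right by lra; intros htt.
      unfold plus; cbn -[pow]; unfold dA.
      pose proof (spos t ltac:(lra)); pose proof (spos theta ltac:(lra)).
      replace (/ (4 * sin theta ^ 2) * (4 * sin t ^ 2))
        with ((sin t * / sin theta) * (sin t * / sin theta)) by (field; lra).
      assert (0 < / sin theta) by (apply Rinv_0_lt_compat; lra).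
      rewrite !ln_mult, ln_Rinv by (repeat apply Rmult_lt_0_compat; lra).
      fold c; as_R; ring.
  - unfold A; fold c; rewrite sin_2a, sin_PI2, cos_PI2, ln_1.
    field; lra.
Qed.

Theorem proposition2 (theta0 : R) (htheta0 : 0 < theta0 < PI / 2) :
  (forall snr : R, is_cutoff snr (4 * sin theta0 ^ 2) <-> snr = SNR theta0) /\
  (forall lcut : R,
     is_cutoff (SNR theta0) lcut <-> lcut = 4 * sin theta0 ^ 2) /\
  (forall c : R,
     is_capacity (SNR theta0) c <->
     c = - (2 * ln 2 + 1) + 4 * theta0 / PI * ln 2
         + 2 / PI * Cl2 (2 * theta0) + 2 * theta0 / PI
         + sin (2 * theta0) / PI
         - (2 - 4 * theta0 / PI) * ln (sin theta0)).
Proof.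
  split; [intros snr; now apply is_cutoff_iff_SNR|].
  split; [intros lcut; now apply is_cutoff_SNR_iff|].
  pose proof (four_sin_sq_bounds theta0 htheta0) as hb.
  pose proof (is_RInt_capacity theta0 htheta0) as hI.
  (* The capacity integrand involves the water level only through its product with the SNR, which
     the unique cutoff determines. *)
  assert (level : forall nu lcut, is_waterfilling (SNR theta0) nu lcut ->
    lcut = 4 * sin theta0 ^ 2 /\ nu * SNR theta0 = / (4 * sin theta0 ^ 2)).
  { intros nu lcut h.
    assert (e : lcut = 4 * sin theta0 ^ 2)
      by (apply is_cutoff_SNR_iff; trivial; now exists nu).
    split; [trivial|]; rewrite <- e.
    destruct h as (hs & hnu & _ & -> & _); field; lra. }
  intros c; split.
  - intros [nu [lcut [h hi]]].
    destruct (level nu lcut h) as [-> e]; rewrite e in hi.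
    rewrite <- (is_RInt_unique (V := R_CompleteNormedModule) _ _ _ _ hi).
    now apply (is_RInt_unique (V := R_CompleteNormedModule)).
  - intros ->.
    destruct (proj2 (is_cutoff_SNR_iff theta0 _ htheta0) eq_refl) as [nu h].
    exists nu, (4 * sin theta0 ^ 2); split; trivial.
    now rewrite (proj2 (level _ _ h)).
Qed.
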